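(* Let $X$ be a CAT(0) space, $C\subseteq X$ a nonempty convex subset, and $T,U:C\to C$ nonexpansive mappings with $Fix(T)\cap Fix(U)\neq\emptyset$. Let $x_0,u\in C$, let $\alpha_n=\frac{2}{n+2}$ and $\beta_n=\beta\in(0,1)$ for all $n\in\mathbb N$, and let $(x_n),(y_n)$ be the alternating Halpern-Mann iteration: for all $n\in\mathbb N$, $y_n=(1-\alpha_n)Tx_n+\alpha_n u$ and $x_{n+1}=(1-\beta_n)Uy_n+\beta_n y_n$. Let $p\in Fix(T)\cap Fix(U)$, $M_p=\max\{d(x_0,p),d(u,p)\}$, and let $K\in\mathbb N$, $K\geq1$, satisfy $K\geq M_p$. Define $$\Lambda=\left\lceil\max\left\{\frac1\beta,\frac1{1-\beta}\right\}\right\rceil.$$ Then: (i) $\Sigma_3(k)=2^6K^2\Lambda^2(k+1)^2-2$ is a rate of $U$-asymptotic regularity of $(y_n)$. (ii) $\lim_{n\to\infty}d(x_n,y_n)=0$ with rate of convergence $\Theta(k)=2^8K^2\Lambda^2(k+1)^2-2$. (iii) $\Sigma_4(k)=2^{10}K^2\Lambda^2(k+1)^2-2$ is a rate of $T$-asymptotic regularity of $(y_n)$. (iv) $\Sigma_5(k)=2^{12}K^2\Lambda^2(k+1)^2-2$ is a rate of $T$-asymptotic regularity and of $U$-asymptotic regularity of $(x_n)$.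
   Context: $\mathbb N=\{0,1,2,\dots\}$. In a CAT(0) space $(X,d)$, for $x,y\in X$ and $\lambda\in[0,1]$, $(1-\lambda)x+\lambda y$ denotes the unique point $z$ of the geodesic segment joining $x$ and $y$ with $d(x,z)=\lambda d(x,y)$ and $d(y,z)=(1-\lambda)d(x,y)$. A nonempty $C\subseteq X$ is convex if $(1-\lambda)x+\lambda y\in C$ for all $x,y\in C$, $\lambda\in[0,1]$. A mapping $S:C\to C$ is nonexpansive if $d(Sx,Sy)\le d(x,y)$ for all $x,y\in C$; $Fix(S)$ is its set of fixed points. $\varphi:\mathbb N\to\mathbb N$ is a rate of convergence of a real sequence $(a_n)$ towards $0$ if $|a_n|\le\frac1{k+1}$ for all $k\in\mathbb N$ and all $n\ge\varphi(k)$. For $S:C\to C$ and $(z_n)$ in $C$, $\varphi$ is a rate of $S$-asymptotic regularity of $(z_n)$ if it is a rate of convergence of $(d(z_n,Sz_n))$ towards $0$. *)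

(* Defs.v *)
From HB Require Import structures.
From mathcomp Require Import all_boot all_order all_algebra.
From mathcomp Require Import all_classical all_reals all_analysis.

Set Implicit Arguments.
Unset Strict Implicit.
Unset Printing Implicit Defensive.
Import Order.TTheory GRing.Theory Num.Theory.
Import numFieldNormedType.Exports.

Local Open Scope classical_set_scope.
Local Open Scope ring_scope.

Section CAT0.
Context {R : realType}.

(* The norm of the library on 'rV[R]_2 is the sup norm, hence an explicit
   Euclidean distance. *)
Definition eucl_dist (a b : 'rV[R]_2) : R :=
  Num.sqrt (\sum_(i < 2) (a 0 i - b 0 i) ^+ 2).

Definition eucl_segment (a b : 'rV[R]_2) : set 'rV[R]_2 :=
  [set (1 - t) *: a + t *: b | t in `[0, 1]].

Context {X : metricType R}.
Implicit Types (x y z p q : X) (S : set X) (a b c : 'rV[R]_2) (C : set X).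

Definition is_geodesic (g : R -> X) x y : Prop :=
  [/\ g 0 = x, g (mdist x y) = y &
      {in `[0, mdist x y] &, forall s t, mdist (g s) (g t) = `|s - t|}].

Definition is_geodesic_segment S x y : Prop :=
  exists g, is_geodesic g x y /\ S = g @` `[0, mdist x y].

Definition comparison_triangle x y z a b c : Prop :=
  [/\ eucl_dist a b = mdist x y,
      eucl_dist b c = mdist y z &
      eucl_dist c a = mdist z x].

(* p' is a comparison point, on the segment [a, b], for the point p of the
   side S joining x to y *)
Definition comparison_point x y S a b p (p' : 'rV[R]_2) : Prop :=
  [/\ S p, eucl_segment a b p' & eucl_dist a p' = mdist x p].

Definition triangle_comparison_point x y z S1 S2 S3 a b c p
    (p' : 'rV[R]_2) : Prop :=
  [\/ comparison_point x y S1 a b p p',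
      comparison_point y z S2 b c p p' |
      comparison_point z x S3 c a p p'].

(* (1 - l) x + l y.  The default value x is only taken when no such point
   exists; see combP and comb_unique below. *)
Definition comb (l : R) x y : X :=
  xget x [set z | exists S, [/\ is_geodesic_segment S x y, S z,
                               mdist x z = l * mdist x y &
                               mdist y z = (1 - l) * mdist x y]].

Definition geod_convex C : Prop :=
  forall x y (l : R), C x -> C y -> 0 <= l <= 1 -> C (comb l x y).

Definition nonexpansive_on C (F : X -> X) : Prop :=
  forall x y, C x -> C y -> mdist (F x) (F y) <= mdist x y.

Definition Fix C (F : X -> X) : set X := [set x | C x /\ F x = x].

Definition alternating_Halpern_Mann (T U : X -> X) (x0 u : X)
    (alpha beta : nat -> R) (x y : nat -> X) : Prop :=
  [/\ x 0%N = x0,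
      forall n, y n = comb (alpha n) (T (x n)) u &
      forall n, x n.+1 = comb (beta n) (U (y n)) (y n)].

Definition rate_of_convergence0 (phi : nat -> nat) (a : nat -> R) : Prop :=
  forall k n : nat, (phi k <= n)%N -> `|a n| <= k.+1%:R^-1.

Definition rate_of_asymptotic_regularity (F : X -> X) (phi : nat -> nat)
    (z : nat -> X) : Prop :=
  rate_of_convergence0 phi (fun n => mdist (z n) (F (z n))).

End CAT0.

Definition CAT0 (R : realType) (X : metricType R) : Prop :=
  (forall x y : X, exists g, is_geodesic g x y) /\
  forall (x y z : X) (S1 S2 S3 : set X),
    is_geodesic_segment S1 x y ->
    is_geodesic_segment S2 y z ->
    is_geodesic_segment S3 z x ->
  forall a b c : 'rV[R]_2, comparison_triangle x y z a b c ->
  forall (p q : X) (p' q' : 'rV[R]_2),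
    triangle_comparison_point x y z S1 S2 S3 a b c p p' ->
    triangle_comparison_point x y z S1 S2 S3 a b c q q' ->
    mdist p q <= eucl_dist p' q'.

Definition Lambda {R : realType} (beta : R) : nat :=
  absz (Num.ceil (Num.max (1 / beta) (1 / (1 - beta)))).

Section comb_theory.
Context {R : realType} {X : metricType R}.
Implicit Types (x y z : X) (S : set X) (l : R).

Lemma geodesic_rev (g : R -> X) x y :
  is_geodesic g x y -> is_geodesic (fun t => g (mdist x y - t)) y x.
Proof.
case=> g0 gd gi; rewrite /is_geodesic (metric_sym y x) subr0 subrr; split => //.
move=> s t; rewrite !in_itv/= => /andP[s0 sd] /andP[t0 td].
rewrite gi ?in_itv/= ?subr_ge0 ?sd ?td ?lerBlDr ?lerDl ?s0 ?t0//.
by rewrite opprB addrC addrA subrK distrC.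
Qed.

Lemma geodesic_segment_sym S x y :
  is_geodesic_segment S x y -> is_geodesic_segment S y x.
Proof.
case=> g [gg ->]; exists (fun t => g (mdist x y - t)).
split; first exact: geodesic_rev.
rewrite (metric_sym y x); apply/seteqP; split => p /= [t].
  rewrite in_itv/= => /andP[t0 td] <-; exists (mdist x y - t); last first.
    by rewrite subKr.
  by rewrite in_itv/= subr_ge0 td lerBlDr lerDl.
rewrite in_itv/= => /andP[t0 td] <-; exists (mdist x y - t) => //.
by rewrite in_itv/= subr_ge0 td lerBlDr lerDl.
Qed.

Lemma combP l x y : CAT0 X -> 0 <= l <= 1 ->
  exists S, [/\ is_geodesic_segment S x y, S (comb l x y),
               mdist x (comb l x y) = l * mdist x y &
               mdist y (comb l x y) = (1 - l) * mdist x y].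
Proof.
case=> geo _ /andP[l0 l1]; rewrite /comb; case: xgetP => //= none; exfalso.
have [g gg] := geo x y; have [g0 gd gi] := gg.
have d0 := mdist_ge0 x y.
have li : l * mdist x y \in `[0, mdist x y].
  by rewrite in_itv/= mulr_ge0//= ler_piMl.
apply: (none (g (l * mdist x y))); exists (g @` `[0, mdist x y]); split.
- by exists g.
- by exists (l * mdist x y).
- rewrite -{1}g0 gi// ?in_itv/= ?lexx//.
  by rewrite sub0r normrN ger0_norm// mulr_ge0.
- rewrite -{1}gd gi// ?in_itv/= ?lexx ?andbT//.
  by rewrite -{1}[mdist x y]mul1r -mulrBl ger0_norm// mulr_ge0 ?subr_ge0.
Qed.

Lemma eucl_distxx (a : 'rV[R]_2) : eucl_dist a a = 0.
Proof.
rewrite /eucl_dist big1 ?sqrtr0// => i _.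
by rewrite subrr expr0n.
Qed.

Lemma comb_unique l x y S S' z z' : CAT0 X -> 0 <= l <= 1 ->
  is_geodesic_segment S x y -> S z -> mdist x z = l * mdist x y ->
  is_geodesic_segment S' x y -> S' z' -> mdist y z' = (1 - l) * mdist x y ->
  z = z'.
Proof.
move=> [_ cat] /andP[l0 l1] Sxy Sz xz S'xy S'z' yz'.
pose d := mdist x y; have d0 : 0 <= d by exact: mdist_ge0.
pose a : 'rV[R]_2 := 0.
pose e : 'rV[R]_2 := \row_i (i == 0)%:R.
have dE s t : eucl_dist (s *: e) (t *: e) = `|s - t|.
  rewrite /eucl_dist big_ord_recl big_ord1 !mxE /= !mulr1 !mulr0 subrr.
  by rewrite expr0n addr0 sqrtr_sqr.
have syy : is_geodesic_segment [set y] y y.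
  exists (fun=> y); rewrite /is_geodesic mdistxx; split; first split => //.
    move=> s t; rewrite !in_itv/= => /andP[s0 s1] /andP[t0 t1].
    have -> : s = 0 by apply/le_anti; rewrite s0 s1.
    have -> : t = 0 by apply/le_anti; rewrite t0 t1.
    by rewrite subrr normr0.
  apply/seteqP; split => p /=; last by case.
  by move=> ->; exists 0; rewrite // in_itv/= lexx.
have lin s : 0 <= s -> s <= 1 -> eucl_segment (0 *: e) (d *: e) ((s * d) *: e).
  move=> s0 s1; exists s; first by rewrite /= in_itv/= s0 s1.
  by rewrite scale0r scaler0 add0r scalerA.
have lin' : eucl_segment (d *: e) (0 *: e) ((l * d) *: e).
  exists (1 - l); first by rewrite /= in_itv/= subr_ge0 l1 lerBlDr lerDl.
  by rewrite scale0r scaler0 addr0 scalerA subKr.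
suff : mdist z z' <= eucl_dist ((l * d) *: e) ((l * d) *: e).
  rewrite eucl_distxx => zz'; apply: mdist_positivity.
  by apply/le_anti; rewrite zz' mdist_ge0.
apply: (cat x y y S [set y] S' Sxy syy (geodesic_segment_sym S'xy)
            (0 *: e) (d *: e) (d *: e)).
- split; rewrite dE ?subrr ?normr0 ?mdistxx//.
    by rewrite sub0r normrN ger0_norm.
  by rewrite subr0 ger0_norm// metric_sym.
- apply: Or31; split => //; first exact: lin.
  by rewrite dE sub0r normrN ger0_norm ?mulr_ge0.
- apply: Or33; split => //.
  by rewrite dE -{1}[d]mul1r -mulrBl ger0_norm ?mulr_ge0 ?subr_ge0.
Qed.

End comb_theory.

(* Main.v *)
Require Import Defs.
From mathcomp Require Import all_boot all_order all_algebra.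
From mathcomp Require Import all_classical all_reals all_analysis.
From mathcomp Require Import ring lra.
Import Order.TTheory GRing.Theory Num.Theory.
Import numFieldNormedType.Exports.

Local Open Scope classical_set_scope.
Local Open Scope ring_scope.

(** With [N = n + 2], convexity of the metric and induction on [n] give
    [d(x_n, x_{n+1}) <= 4K/N]; as [y_n] lies at distance [alpha_n d(T x_n, u)]
    from [T x_n], also [d(y_n, T x_n) <= 4K/N].  The CN inequality at [p] bounds
    [beta (1 - beta) d(y_n, U y_n)^2] by [d(y_n, p)^2 - d(x_{n+1}, p)^2], which
    is at most [(6K/N)(2K)].  All other displacements are controlled by these
    three through the triangle inequality, and [1 <= beta (1 - beta) Lambda^2]
    turns the bounds into the stated rates. *)

(** * Coordinates in the Euclidean plane *)

Lemma sqr_eucl_dist (R : realType) (a b : 'rV[R]_2) :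
  eucl_dist a b ^+ 2 =
  (a 0 0 - b 0 0) ^+ 2 + (a 0 (lift 0 0) - b 0 (lift 0 0)) ^+ 2.
Proof.
rewrite /eucl_dist sqr_sqrtr; first by rewrite big_ord_recl big_ord1.
by apply: sumr_ge0 => i _; exact: sqr_ge0.
Qed.

Lemma eucl_dist_scale (R : realType) (k : R) (a b c d : 'rV[R]_2) :
  0 <= k -> a - b = k *: (c - d) -> eucl_dist a b = k * eucl_dist c d.
Proof.
move=> k0 /rowP e; apply/eqP.
rewrite -(@eqrXn2 _ 2)// ?mulr_ge0 ?sqrtr_ge0// exprMn !sqr_eucl_dist.
by have := e 0; have := e (lift 0 0); rewrite !mxE => -> ->; apply/eqP; ring.
Qed.

(** * Comparison triangles and convexity estimates for geodesic combinations *)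

Section geodesic_combinations.
Context {R : realType} {X : metricType R}.
Implicit Types (x y z : X) (l : R).

(** Put [x] at the origin and [y] on the first axis; the law of cosines gives the abscissa [s] of
    [z], and the triangle inequalities make its squared height nonnegative. *)
Lemma comparison_triangle_exists x y z :
  exists a b c, comparison_triangle x y z a b c.
Proof.
have := mdist_ge0 x y; have := mdist_ge0 y z; have := mdist_ge0 z x.
have := metric_triangle z x y; have := metric_triangle x y z.
have := metric_triangle x z y.
rewrite (metric_sym z y) (metric_sym x z).
rewrite /comparison_triangle.
move: (mdist x y) (mdist y z) (mdist z x) => d e f t1 t2 t3 f0 e0 d_ge0.
have P (s t : R) (a b : 'rV[R]_2) (r : R) : 0 <= r ->
    (a 0 0 - b 0 0) ^+ 2 + (a 0 (lift 0 0) - b 0 (lift 0 0)) ^+ 2 = r ^+ 2 ->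
    eucl_dist a b = r.
  move=> r0; rewrite -sqr_eucl_dist => /eqP.
  by rewrite eqrXn2 ?sqrtr_ge0// => /eqP.
(* If [d = 0] the formula for [s] breaks down, but then [e = f] and a flat triangle works. *)
move: (d_ge0); rewrite le_eqVlt => /predU1P[d0|d0].
  have ef : e = f by lra.
  exists 0, 0, (\row_i (f *+ (i == 0))).
  by split; apply: P => //; rewrite !mxE/= ?mulr0n ?mulr1n -?d0 ?ef; ring.
pose s := (d ^+ 2 + f ^+ 2 - e ^+ 2) / (2 * d).
have sE : 2 * d * s = d ^+ 2 + f ^+ 2 - e ^+ 2.
  by rewrite /s; field; rewrite gt_eqF.
have s2 : 0 <= f ^+ 2 - s ^+ 2.
  (* Heron's formula: the scaled squared height is 16 times the squared area and factors into
     triangle defects. *)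
  have : 0 <= (2 * d) ^+ 2 * (f ^+ 2 - s ^+ 2).
    rewrite mulrBr -!exprMn sE.
    have -> : (2 * d * f) ^+ 2 - (d ^+ 2 + f ^+ 2 - e ^+ 2) ^+ 2 =
      ((e + d - f) * (e + f - d)) * ((d + f - e) * (d + f + e)) by ring.
    by apply: mulr_ge0; apply: mulr_ge0; lra.
  by rewrite pmulr_rge0// exprn_gt0// mulr_gt0.
exists 0, (\row_i (d *+ (i == 0))),
  (\row_i (if i == 0 then s else Num.sqrt (f ^+ 2 - s ^+ 2))).
by split; apply: P; rewrite ?(ltW d0)// !mxE/= ?mulr0n ?mulr1n;
  rewrite ?sub0r ?subr0 ?sqrrN ?sqr_sqrtr//; nra.
Qed.

Context (cat0X : CAT0 X).

(* The CN inequality of Bruhat and Tits. *)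
Lemma sqr_mdist_comb_le l x y z : 0 <= l <= 1 ->
  mdist (comb l x y) z ^+ 2 <=
  (1 - l) * mdist x z ^+ 2 + l * mdist y z ^+ 2
    - l * (1 - l) * mdist x y ^+ 2.
Proof.
move=> l01; have [l0 l1] := andP l01; have [geo cat] := cat0X.
have [a [b [c abc]]] := comparison_triangle_exists x y z.
have [ab bc ca] := abc.
have [S [Sg Sc xc yc]] := combP x y cat0X l01.
have [g2 gg2] := geo y z; have [g3 gg3] := geo z x.
pose w := (1 - l) *: a + l *: b.
have : mdist (comb l x y) z <= eucl_dist w c.
  apply: (cat x y z S (g2 @` `[0, mdist y z]) (g3 @` `[0, mdist z x])
    _ _ _ a b c abc) => //.
  - by exists g2.
  - by exists g3.
  - apply: Or31; split => //; first by exists l; rewrite //= in_itv.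
    rewrite xc -ab; apply: eucl_dist_scale => //.
    by apply/rowP => i; rewrite !mxE; ring.
  (* The vertex [z] is viewed as the far end of the side from [y] to [z], with comparison point
     [c]. *)
  - apply: Or32; split => //.
    + by exists (mdist y z); [rewrite /= in_itv/= lexx mdist_ge0 | case: gg2].
    + by exists 1; rewrite /= ?in_itv/= ?lexx ?ler01// subrr scale0r add0r scale1r.
rewrite -(@ler_pXn2r _ 2)// ?nnegrE ?mdist_ge0 ?sqrtr_ge0// => /le_trans; apply.
(* In the plane the inequality is an equality, Stewart's theorem. *)
rewrite (metric_sym x z) -ab -bc -ca !sqr_eucl_dist !mxE le_eqVlt.
by apply/orP; left; apply/eqP; ring.
Qed.

(** The square of the right-hand side exceeds the CN bound by [l (1 - l)] times
    [d(x,y)^2 - (d(x,z) - d(y,z))^2], which is nonnegative by the triangle inequality. *)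
Lemma mdist_comb_le l x y z : 0 <= l <= 1 ->
  mdist (comb l x y) z <= (1 - l) * mdist x z + l * mdist y z.
Proof.
move=> l01; have [l0 l1] := andP l01.
have := mdist_ge0 x z; have := mdist_ge0 y z; have := mdist_ge0 x y.
move=> d0 yz0 xz0.
rewrite -(@ler_pXn2r _ 2)// ?nnegrE ?mdist_ge0//; last first.
  by rewrite addr_ge0// mulr_ge0 ?subr_ge0.
apply: (le_trans (sqr_mdist_comb_le l x y z l01)).
have t : (mdist x z - mdist y z) ^+ 2 <= mdist x y ^+ 2.
  have := metric_triangle x y z; have := metric_triangle y x z.
  by rewrite (metric_sym y x) => ? ?; nra.
have := ler_wpM2l (_ : 0 <= l * (1 - l)) t.
by rewrite mulr_ge0 ?subr_ge0// => /(_ isT); nra.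
Qed.

(** Since [comb] is a choice, the symmetry comes from uniqueness, after reversing a geodesic
    segment. *)
Lemma comb_sym l x y : 0 <= l <= 1 -> comb l x y = comb (1 - l) y x.
Proof.
move=> l01; have l01' : 0 <= 1 - l <= 1 by lra.
have [S [Sg Sc xc yc]] := combP x y cat0X l01.
have [S' [Sg' Sc' yc' xc']] := combP y x cat0X l01'.
apply: (comb_unique cat0X l01 Sg Sc xc (geodesic_segment_sym Sg') Sc').
by rewrite yc' metric_sym.
Qed.

(** The comparison points are the images of [a] and [b] under the homothety of centre [c] and ratio
    [l], so the planar distance is exactly [l * d(x,y)]. *)
Lemma mdist_comb_same_start l x y z : 0 <= l <= 1 ->
  mdist (comb l z x) (comb l z y) <= l * mdist x y.
Proof.
move=> l01; have [l0 l1] := andP l01; have [geo cat] := cat0X.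
have [a [b [c abc]]] := comparison_triangle_exists x y z.
have [ab bc ca] := abc.
have [S3 [Sg3 Sc3 zc3 xc3]] := combP z x cat0X l01.
have [S2 [Sg2 Sc2 zc2 yc2]] := combP z y cat0X l01.
have [g gg] := geo x y.
have <- : eucl_dist ((1 - l) *: c + l *: a) ((1 - l) *: c + l *: b)
    = l * mdist x y.
  rewrite -ab; apply: eucl_dist_scale => //.
  by apply/rowP => i; rewrite !mxE; ring.
apply: (cat x y z (g @` `[0, mdist x y]) S2 S3 _ _ _ a b c abc) => //.
- by exists g.
- exact: geodesic_segment_sym.
- apply: Or33; split => //; first by exists l; rewrite //= in_itv.
  rewrite zc3 -ca; apply: eucl_dist_scale => //.
  by apply/rowP => i; rewrite !mxE; ring.
- apply: Or32; split => //.
    (* This side is traversed from [b] to [c], whence the complementary parameter. *)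
    by exists (1 - l); [rewrite /= in_itv/=; lra | rewrite subKr addrC].
  rewrite yc2 (metric_sym z y) -bc; apply: eucl_dist_scale; first by lra.
  by apply/rowP => i; rewrite !mxE; ring.
Qed.

Lemma mdist_comb_comb_le l x y x' y' : 0 <= l <= 1 ->
  mdist (comb l x y) (comb l x' y') <= (1 - l) * mdist x x' + l * mdist y y'.
Proof.
move=> l01; have l01' : 0 <= 1 - l <= 1 by lra.
(* The intermediate point shares the endpoint [y] with the first combination and [x'] with the
   second. *)
apply: (le_trans (metric_triangle _ (comb l x' y) _)).
apply: lerD; last exact: mdist_comb_same_start.
by rewrite (comb_sym l x y l01) (comb_sym l x' y l01); exact: mdist_comb_same_start.
Qed.

(** CN with third point [comb l' x y]: the coefficient of [d(x,y)^2] collapses to [(l - l')^2]. The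
    two points need not be placed on a common segment. *)
Lemma mdist_comb_weights l l' x y : 0 <= l <= 1 -> 0 <= l' <= 1 ->
  mdist (comb l x y) (comb l' x y) <= `|l - l'| * mdist x y.
Proof.
move=> l01 l01'; have [S [_ _ xc yc]] := combP x y cat0X l01'.
rewrite -(@ler_pXn2r _ 2)// ?nnegrE ?mulr_ge0 ?mdist_ge0//.
apply: (le_trans (sqr_mdist_comb_le l x y _ l01)).
by rewrite xc yc !exprMn real_normK ?num_real//; nra.
Qed.

End geodesic_combinations.

(** * Quantitative estimates along the alternating Halpern-Mann iteration *)

Section alternating_Halpern_Mann_estimates.
Context {R : realType} {X : metricType R} {C : set X} {T U : X -> X}.
Context {x0 u p : X} {alpha beta_ : nat -> R} {beta K : R} {x y : nat -> X}.
Hypotheses (cat0X : CAT0 X) (cvxC : geod_convex C).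
Hypotheses (CT : set_fun C C T) (CU : set_fun C C U).
Hypotheses (neT : nonexpansive_on C T) (neU : nonexpansive_on C U).
Hypotheses (Cx0 : C x0) (Cu : C u).
Hypothesis alphaE : forall n, alpha n = 2 / (n + 2)%:R.
Hypotheses (beta01 : 0 < beta < 1) (beta_E : forall n, beta_ n = beta).
Hypothesis iter : alternating_Halpern_Mann T U x0 u alpha beta_ x y.
Hypothesis fixp : (Fix C T `&` Fix C U) p.
Hypotheses (x0p : mdist x0 p <= K) (up : mdist u p <= K).

Let Nn (n : nat) : R := n.+2%:R.

Let Nn_ge2 n : 2 <= Nn n.
Proof. by rewrite /Nn ler_nat. Qed.

Let NnS n : Nn n.+1 = Nn n + 1.
Proof. by rewrite /Nn -natr1. Qed.

Let alphaN n : alpha n = 2 / Nn n.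
Proof. by rewrite alphaE addn2. Qed.

Let alpha01 n : 0 <= alpha n <= 1.
Proof.
have N2 := Nn_ge2 n; have N0 : 0 < Nn n by lra.
by rewrite alphaN ler_pdivrMr// mul1r N2 divr_ge0// ltW.
Qed.

Let alpha_ge0 n : 0 <= alpha n.
Proof. by case/andP: (alpha01 n). Qed.

Let beta01w : 0 <= beta <= 1.
Proof. by case/andP: beta01 => b0 b1; rewrite !ltW. Qed.

Let yE n : y n = comb (alpha n) (T (x n)) u.
Proof. by case: iter. Qed.

Let xSE n : x n.+1 = comb beta (U (y n)) (y n).
Proof. by case: iter => _ _ ->; rewrite beta_E. Qed.

Lemma iterates_in n : C (x n) /\ C (y n).
Proof.
have Cxy m : C (x m) -> C (x m) /\ C (y m).
  by move=> Cx; split => //; rewrite yE; apply: cvxC => //; exact: CT.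
elim: n => [|n [_ IH]]; apply: Cxy; first by case: iter => ->.
by rewrite xSE; apply: cvxC => //; exact: CU.
Qed.

Let Cx n : C (x n). Proof. by case: (iterates_in n). Qed.
Let Cy n : C (y n). Proof. by case: (iterates_in n). Qed.

Let Tp_le n : mdist (T (x n)) p <= mdist (x n) p.
Proof. by case: fixp => -[Cp Tp] _; rewrite -{1}Tp; exact: neT. Qed.

Let Up_le n : mdist (U (y n)) p <= mdist (y n) p.
Proof. by case: fixp => _ [Cp Up]; rewrite -{1}Up; exact: neU. Qed.

Let yp_le n : mdist (y n) p <= (1 - alpha n) * mdist (x n) p + alpha n * K.
Proof.
have a01 := alpha01 n; rewrite yE.
apply: (le_trans (mdist_comb_le cat0X _ _ _ _ a01)).
by apply: lerD; apply: ler_wpM2l => //; lra.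
Qed.

Lemma iterates_bounded n : mdist (x n) p <= K /\ mdist (y n) p <= K.
Proof.
have xyK m : mdist (x m) p <= K -> mdist (x m) p <= K /\ mdist (y m) p <= K.
  by move=> xK; split => //; apply: (le_trans (yp_le m)); have := alpha01 m; nra.
elim: n => [|n [_ IH]]; apply: xyK; first by case: iter => ->.
rewrite xSE; apply: (le_trans (mdist_comb_le cat0X _ _ _ _ beta01w)).
have := Up_le n; have := beta01w; nra.
Qed.

Let xK n : mdist (x n) p <= K. Proof. by case: (iterates_bounded n). Qed.
Let yK n : mdist (y n) p <= K. Proof. by case: (iterates_bounded n). Qed.

Let Txu n : mdist (T (x n)) u <= 2 * K.
Proof.
have := metric_triangle (T (x n)) p u; have := Tp_le n; have := xK n.
by rewrite (metric_sym p u); move: up; lra.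
Qed.

Lemma mdist_y_Tx n : mdist (y n) (T (x n)) <= 4 * K / n.+2%:R.
Proof.
have a01 := alpha01 n.
have [S [_ _ + _]] := combP (T (x n)) u cat0X a01.
rewrite -yE metric_sym => ->.
have -> : 4 * K / n.+2%:R = alpha n * (2 * K) by rewrite alphaN; ring.
by apply: ler_wpM2l => //; lra.
Qed.

Let mdist_yS n : mdist (y n) (y n.+1) <=
  (1 - alpha n.+1) * mdist (x n) (x n.+1) + (alpha n - alpha n.+1) * (2 * K).
Proof.
have a01 := alpha01 n; have a01' := alpha01 n.+1.
have aS : alpha n.+1 <= alpha n.
  rewrite !alphaN ler_pM2l// lef_pV2 ?posrE; have := Nn_ge2 n; rewrite ?NnS; lra.
rewrite !yE.
(* The change is split in two: first the weight moves with [T (x n)] fixed, then the point moves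
   with the weight fixed. *)
apply: (le_trans (metric_triangle _ (comb (alpha n.+1) (T (x n)) u) _)).
rewrite addrC; apply: lerD.
  apply: (le_trans (mdist_comb_comb_le cat0X _ _ _ _ _ a01')).
  by rewrite mdistxx mulr0 addr0; apply: ler_wpM2l; [lra|exact: neT].
apply: (le_trans (mdist_comb_weights cat0X _ _ _ _ a01 a01')).
by rewrite ger0_norm ?subr_ge0//; apply: ler_wpM2l => //; rewrite subr_ge0.
Qed.

Lemma mdist_xS n : mdist (x n) (x n.+1) <= 4 * K / n.+2%:R.
Proof.
elim: n => [|n IH].
  (* At [n = 0] the bound is [2 * K], which is the bound through [p]. *)
  have := metric_triangle (x 0%N) p (x 1%N); rewrite (metric_sym p).
  have := xK 0; have := xK 1; lra.
(* The Mann step is nonexpansive in [y n] because its weight is constant. *)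
have xy : mdist (x n.+1) (x n.+2) <= mdist (y n) (y n.+1).
  rewrite !xSE.
  apply: (le_trans (mdist_comb_comb_le cat0X _ _ _ _ _ beta01w)).
  have := neU (y n) (y n.+1) (Cy n) (Cy n.+1); have := beta01w; nra.
apply: (le_trans xy); apply: (le_trans (mdist_yS n)).
(* For [alpha n = 2 / (n + 2)] the claimed bound solves the recurrence exactly. *)
have -> : 4 * K / n.+3%:R =
    (1 - alpha n.+1) * (4 * K / n.+2%:R) + (alpha n - alpha n.+1) * (2 * K).
  rewrite !alphaN -/(Nn n) -/(Nn n.+1) NnS; have := Nn_ge2 n => N2.
  by field; apply/andP; split; apply: lt0r_neq0; lra.
by rewrite lerD2r; apply: ler_wpM2l => //; have := alpha01 n.+1; lra.
Qed.

(** The path goes through [x n.+1], which lies at distance [(1 - beta) d(y_n, U y_n)] from [y n]. *)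
Lemma mdist_xy n : mdist (x n) (y n) <=
  mdist (x n) (x n.+1) + mdist (y n) (U (y n)).
Proof.
apply: (le_trans (metric_triangle _ (x n.+1) _)); rewrite lerD2l.
have [S [_ _ _ +]] := combP (U (y n)) (y n) cat0X beta01w.
rewrite -xSE metric_sym (metric_sym (y n) (U (y n))) => ->.
by rewrite ler_piMl ?mdist_ge0// lerBlDr lerDl; case/andP: beta01w.
Qed.

Lemma mdist_y_Ty n : mdist (y n) (T (y n)) <=
  mdist (x n) (y n) + mdist (y n) (T (x n)).
Proof.
apply: (le_trans (metric_triangle _ (T (x n)) _)).
by rewrite addrC lerD2r; exact: neT.
Qed.

(** The path is [x n], [y n], [U (y n)], [U (x n)]; nonexpansiveness makes the last leg no longer
    than the first. *)
Lemma mdist_x_Ux n : mdist (x n) (U (x n)) <=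
  2 * mdist (x n) (y n) + mdist (y n) (U (y n)).
Proof.
have := metric_triangle (x n) (y n) (U (x n)).
have := metric_triangle (y n) (U (y n)) (U (x n)).
by have := neU (y n) (x n) (Cy n) (Cx n); rewrite (metric_sym (y n) (x n)); lra.
Qed.

Lemma sqr_mdist_y_Uy n :
  beta * (1 - beta) * mdist (y n) (U (y n)) ^+ 2 <= 12 * K ^+ 2 / n.+2%:R.
Proof.
have := sqr_mdist_comb_le cat0X _ (U (y n)) (y n) p beta01w.
rewrite -xSE (metric_sym (U (y n)) (y n)).
have K0 : 0 <= K := le_trans (mdist_ge0 _ _) up.
(* Here [6 = 4 + 2]: the step from [x n] to [x n.+1] costs [4K/N] and the anchor term [alpha n * K]
   costs [2K/N]. *)
have dyx : mdist (y n) p - mdist (x n.+1) p <= 6 * K / n.+2%:R.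
  have := metric_triangle (x n) (x n.+1) p; have := mdist_xS n.
  have := yp_le n; have := mulr_ge0 (alpha_ge0 n) (mdist_ge0 (x n) p).
  have -> : 6 * K / n.+2%:R = 4 * K / n.+2%:R + alpha n * K.
    by rewrite alphaN; ring.
  move: (mdist (x n) (x n.+1)) (mdist (x n.+1) p) (mdist (x n) p) (mdist (y n) p).
  by move: (4 * K / _) (alpha n) => *; lra.
have := Up_le n; have := mdist_ge0 (U (y n)) p; have := yK n; have := xK n.+1.
have := mdist_ge0 (x n.+1) p.
have -> : 12 * K ^+ 2 / n.+2%:R = (6 * K / n.+2%:R) * (2 * K) by ring.
have : 0 <= 6 * K / n.+2%:R by rewrite divr_ge0 ?mulr_ge0.
move: (6 * K / _) dyx => e; move: (mdist (U _) p) (mdist (y n) (U _)).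
move: (mdist (y n) p) (mdist (x n.+1) p) => a b w D dyx e0 b0 bK aK w0 wa CN.
have w2 : w ^+ 2 <= a ^+ 2 by nra.
have ab : a ^+ 2 - b ^+ 2 <= e * (2 * K).
  have -> : a ^+ 2 - b ^+ 2 = (a - b) * (a + b) by ring.
  (* The difference [a - b] may be negative, so the factors are multiplied only when it is
     positive. *)
  have [?|?] := lerP a b; first by nra.
  by apply: ler_pM; lra.
have := ler_wpM2l (_ : 0 <= 1 - beta) w2.
rewrite subr_ge0; case/andP: beta01w => _ -> /(_ isT); lra.
Qed.

End alternating_Halpern_Mann_estimates.

(** * From the estimates to explicit rates *)

Lemma Lambda_ge (R : realType) (beta : R) : 0 < beta < 1 ->
  1 <= beta * (Lambda beta)%:R /\ 1 <= (1 - beta) * (Lambda beta)%:R.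
Proof.
move=> /andP[b0 b1]; have b1' : 0 < 1 - beta by lra.
set m := Num.max (1 / beta) (1 / (1 - beta)).
have m0 : 0 < m by rewrite lt_max divr_gt0.
have mL : m <= (Lambda beta)%:R.
  (* The ceiling is positive, so [absz] does not change it. *)
  rewrite /Lambda natr_absz ger0_norm; first exact: ceil_ge.
  by rewrite ltW// ceil_gt0.
move: mL; rewrite ge_max !ler_pdivrMr// => /andP[? ?].
by split; rewrite mulrC.
Qed.

Lemma rate_of_convergence0_cvg (R : realType) (phi : nat -> nat) (a : nat -> R) :
  rate_of_convergence0 phi a -> a n @[n --> \oo] --> (0 : R).
Proof.
move=> rate; apply/cvgrPdist_le => e e0.
have [k _ ke] := near_infty_natSinv_lt (PosNum e0).
exists (phi k) => // n /= kn; rewrite sub0r normrN.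
by apply: le_trans (rate _ _ kn) _; apply/ltW/ke => /=.
Qed.

(* [r] is a free scale: the four rates are the cases [r = 2, 4, 8, 16]. *)
Lemma scaled_displacement_bounds (R : realType) (K L k r n : nat) (b D s : R) :
  (0 < K)%N -> (0 < r)%N ->
  1 <= b * L%:R -> 1 <= (1 - b) * L%:R -> 0 < b < 1 -> 0 <= D ->
  b * (1 - b) * D ^+ 2 <= 12 * K%:R ^+ 2 / n.+2%:R ->
  s <= 4 * K%:R / n.+2%:R ->
  (16 * r ^ 2 * K ^ 2 * L ^ 2 * (k + 1) ^ 2 - 2 <= n)%N ->
  D <= (r * k.+1)%:R^-1 /\ s <= (r * k.+1)%:R^-1.
Proof.
move=> K0 r0 bL b1L b01 D0 hD hs.
(* The truncated subtraction becomes a lower bound on [n + 2], the denominator in the estimates. *)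
rewrite leq_subLR add2n addn1 -(ler_nat R) !(natrM, natrX).
have K1 : 1 <= K%:R :> R by rewrite (ler_nat R 1).
have r1 : 1 <= r%:R :> R by rewrite (ler_nat R 1).
have k1 : 1 <= k.+1%:R :> R by rewrite (ler_nat R 1).
have N0 : 0 < n.+2%:R :> R by rewrite ltr0n.
move: hD hs; rewrite !ler_pdivlMr//.
move: (K%:R) (r%:R) (k.+1%:R) (n.+2%:R) (L%:R) K1 r1 k1 N0 bL b1L.
move=> {K0 r0 K}K {r}r {k}k N {L}L K1 r1 k1 N0 bL b1L hD hs hN.
have L1 : 1 <= L by nra.
have rk1 : 1 <= r * k by nra.
have bb : 1 <= b * (1 - b) * L ^+ 2.
  have -> : b * (1 - b) * L ^+ 2 = (b * L) * ((1 - b) * L) by ring.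
  by nra.
split.
- rewrite -[leRHS]mul1r ler_pdivlMr; last by lra.
  rewrite -(@ler_pXn2r _ 2)// ?nnegrE ?mulr_ge0//; try lra.
  (* Multiplying by [L ^+ 2] removes [b (1 - b)], thanks to [bb]. *)
  have DN : D ^+ 2 * N <= 12 * K ^+ 2 * L ^+ 2.
    have DN0 : 0 <= D ^+ 2 * N by rewrite mulr_ge0 ?sqr_ge0// ltW.
    have := ler_wpM2r (sqr_ge0 L) hD; have := ler_wpM2r DN0 bb; lra.
  have KL : 0 < K ^+ 2 * L ^+ 2 by rewrite mulr_gt0 ?exprn_gt0//; lra.
  (* It remains to see that [12 r^2 K^2 L^2 k^2] is at most [N], which the constant 16 covers. *)
  rewrite expr1n -(@ler_pM2r _ (12 * (K ^+ 2 * L ^+ 2)))//; last by lra.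
  apply: le_trans (_ : D ^+ 2 * N <= _); last by lra.
  have -> : (D * (r * k)) ^+ 2 * (12 * (K ^+ 2 * L ^+ 2)) =
    D ^+ 2 * (12 * r ^+ 2 * K ^+ 2 * L ^+ 2 * k ^+ 2) by ring.
  apply: ler_wpM2l; first exact: sqr_ge0.
  apply: le_trans hN; have : 0 <= r ^+ 2 * K ^+ 2 * L ^+ 2 * k ^+ 2.
    by rewrite -!exprMn sqr_ge0.
  lra.
- rewrite -[leRHS]mul1r ler_pdivlMr; last by lra.
  rewrite -(ler_pM2r N0); apply: le_trans (_ : 4 * K * (r * k) <= _).
    have -> : s * (r * k) * N = (s * N) * (r * k) by ring.
    by apply: ler_wpM2r => //; lra.
  (* The displacement [s] needs only [4 K r k <= N]; the remaining factor of the threshold is at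
     least 1. *)
  rewrite mul1r; apply: le_trans hN.
  have -> : 16 * r ^+ 2 * K ^+ 2 * L ^+ 2 * k ^+ 2 =
    (4 * K * (r * k)) * (4 * (K * L ^+ 2 * (r * k))) by ring.
  have KL : 1 <= K * L ^+ 2 * (r * k).
    by rewrite -[1]mulr1 ler_pM// -[1]mulr1 ler_pM// expr_ge1//; lra.
  rewrite ler_peMr//; last by lra.
  by rewrite !mulr_ge0//; lra.
Qed.

Theorem proposition3p9 (R : realType) (X : metricType R) (C : set X)
    (T U : X -> X) (x0 u : X) (alpha beta_ : nat -> R) (beta : R)
    (x y : nat -> X) (p : X) (K : nat) :
  CAT0 X ->
  C !=set0 -> geod_convex C ->
  set_fun C C T -> set_fun C C U ->
  nonexpansive_on C T -> nonexpansive_on C U ->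
  Fix C T `&` Fix C U !=set0 ->
  C x0 -> C u ->
  (forall n, alpha n = 2 / (n + 2)%:R) ->
  0 < beta < 1 -> (forall n, beta_ n = beta) ->
  alternating_Halpern_Mann T U x0 u alpha beta_ x y ->
  (Fix C T `&` Fix C U) p ->
  (1 <= K)%N -> Num.max (mdist x0 p) (mdist u p) <= K%:R ->
  [/\ rate_of_asymptotic_regularity U
        (fun k => 2 ^ 6 * K ^ 2 * Lambda beta ^ 2 * (k + 1) ^ 2 - 2)%N y,
      (mdist (x n) (y n) @[n --> \oo] --> (0 : R)) /\
      rate_of_convergence0
        (fun k => 2 ^ 8 * K ^ 2 * Lambda beta ^ 2 * (k + 1) ^ 2 - 2)%N
        (fun n => mdist (x n) (y n)),
      rate_of_asymptotic_regularity T
        (fun k => 2 ^ 10 * K ^ 2 * Lambda beta ^ 2 * (k + 1) ^ 2 - 2)%N y &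
      rate_of_asymptotic_regularity T
        (fun k => 2 ^ 12 * K ^ 2 * Lambda beta ^ 2 * (k + 1) ^ 2 - 2)%N x /\
      rate_of_asymptotic_regularity U
        (fun k => 2 ^ 12 * K ^ 2 * Lambda beta ^ 2 * (k + 1) ^ 2 - 2)%N x].
Proof.
move=> cat0X _ cvxC CT CU neT neU _ Cx0 Cu alphaE beta01 beta_E iter fixp K1.
rewrite ge_max => /andP[x0p up].
have [bL b1L] := Lambda_ge _ _ beta01.
(* With [e = 1 / (r (k + 1))], the basic displacements are at most [e], [2e] and [e]. *)
have bounds (r k n : nat) : (0 < r)%N ->
    (16 * r ^ 2 * K ^ 2 * Lambda beta ^ 2 * (k + 1) ^ 2 - 2 <= n)%N ->
    [/\ mdist (y n) (U (y n)) <= r%:R^-1 * k.+1%:R^-1,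
        mdist (x n) (y n) <= 2 * (r%:R^-1 * k.+1%:R^-1) &
        mdist (y n) (T (x n)) <= r%:R^-1 * k.+1%:R^-1].
  move=> r0 rn; rewrite -invfM -natrM.
  have yUy : beta * (1 - beta) * mdist (y n) (U (y n)) ^+ 2
      <= 12 * K%:R ^+ 2 / n.+2%:R.
    exact: (sqr_mdist_y_Uy cat0X cvxC CT CU neT neU Cx0 Cu
      alphaE beta01 beta_E iter fixp x0p up).
  have bound s hs := scaled_displacement_bounds _ _ _ _ _ _ _ _ s K1 r0 bL b1L
    beta01 (mdist_ge0 _ _) yUy hs rn.
  have xS : mdist (x n) (x n.+1) <= 4 * K%:R / n.+2%:R.
    exact: (mdist_xS cat0X cvxC CT CU neT neU Cx0 Cu
      alphaE beta01 beta_E iter fixp x0p up).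
  have yTx : mdist (y n) (T (x n)) <= 4 * K%:R / n.+2%:R.
    exact: (mdist_y_Tx cat0X cvxC CT CU neT neU Cx0 Cu
      alphaE beta01 beta_E iter fixp x0p up).
  have [? ?] := bound _ xS; have [_ ?] := bound _ yTx; split => //.
  have xy : mdist (x n) (y n) <= mdist (x n) (x n.+1) + mdist (y n) (U (y n)).
    exact: (mdist_xy cat0X beta01 beta_E iter).
  by apply: (le_trans xy); rewrite mulr_natl mulr2n lerD.
have e0 k : 0 <= k.+1%:R^-1 :> R by rewrite invr_ge0.
have xy_rate : rate_of_convergence0
    (fun k => 2 ^ 8 * K ^ 2 * Lambda beta ^ 2 * (k + 1) ^ 2 - 2)%N
    (fun n => mdist (x n) (y n)).
  move=> k n /(bounds 4%N k n isT)[_ + _]; rewrite ger0_norm ?mdist_ge0//.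
  by move: (k.+1%:R^-1) (e0 k) => e *; lra.
(* For [r = 2, 4, 8, 16] the factor [16 * r ^ 2] is [2 ^ 6, 2 ^ 8, 2 ^ 10, 2 ^ 12]. The totals are
   [e] in (i), [2e] in (ii), [3e] in (iii), and [3e] for [T] and [5e] for [U] in (iv), each at most
   [r * e]. *)
split; [|split => //; exact: rate_of_convergence0_cvg xy_rate| |split];
  move=> k n kn; rewrite ger0_norm ?mdist_ge0//.
- have [+ _ _] := bounds 2%N k n isT kn.
  by move: (k.+1%:R^-1) (e0 k) => e *; lra.
- apply: le_trans (mdist_y_Ty cvxC CT CU neT Cx0 Cu alphaE beta01 beta_E iter n) _.
  have [_ + +] := bounds 8%N k n isT kn.
  by move: (k.+1%:R^-1) (e0 k) => e *; lra.
- apply: le_trans (metric_triangle _ (y n) _) _.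
  have [_ + +] := bounds 16%N k n isT kn.
  by move: (k.+1%:R^-1) (e0 k) => e *; lra.
- apply: le_trans (mdist_x_Ux cvxC CT CU neU Cx0 Cu alphaE beta01 beta_E iter n) _.
  have [+ + _] := bounds 16%N k n isT kn.
  by move: (k.+1%:R^-1) (e0 k) => e *; lra.
Qed.
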